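(* Let $b\ge 2$ and $m,s\ge 1$ be integers, let $\mathcal{P}$ be a digital net over $\mathbb{Z}_b$ in $G^s$ (with generating matrices $C_1,\ldots,C_s\in\mathbb{Z}_b^{\mathbb{N}\times m}$), and let $\mathcal{P}^{\perp}$ be its dual net. For any continuous function $f:[0,1]^s\to\mathbb{R}$ which satisfies $\sum_{\boldsymbol{k}\in\mathbb{N}_0^s}|\hat f(\boldsymbol{k})|<\infty$, we have $$I(f;\pi(\mathcal{P}_{b\text{-}\mathrm{ant}}))-I(f)=\sum_{\substack{\boldsymbol{k}\in\mathcal{P}^{\perp}\setminus\{\boldsymbol{0}\}\\ \delta(\boldsymbol{k})=0}}\hat f(\boldsymbol{k}),$$ where $\mathcal{P}_{b\text{-}\mathrm{ant}}$ is the $b$-adic antithetic sampling of $\mathcal{P}$.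
   Context: Notation: $\mathbb{N}=\{1,2,\ldots\}$, $\mathbb{N}_0=\mathbb{N}\cup\{0\}$, $\omega_b=\exp(2\pi\sqrt{-1}/b)$. $\mathbb{Z}_b$ is the ring of integers modulo $b$, identified with $\{0,\ldots,b-1\}$. $G=\prod_{i\ge1}\mathbb{Z}_b$ is the infinite direct product group; $\oplus$ denotes componentwise addition modulo $b$ in $\mathbb{Z}_b$, $G$, $G^s$ and in $\mathbb{Z}_b^m$. Projection: $\pi:G\to[0,1]$, $\pi(\zeta_1,\zeta_2,\ldots)=\sum_{i\ge1}\zeta_i b^{-i}$ (with each $\zeta_i$ regarded as an integer in $\{0,\ldots,b-1\}$), applied componentwise to $G^s$. All point sets are finite and counted with multiplicity (i.e. are indexed families/multisets). Digital net: given $C_1,\ldots,C_s\in\mathbb{Z}_b^{\mathbb{N}\times m}$ (infinitely many rows, $m$ columns, no finiteness condition on the columns), for $0\le h<b^m$ with $h=\eta_0+\eta_1b+\cdots+\eta_{m-1}b^{m-1}$, $\eta_i\in\{0,\ldots,b-1\}$, let $\boldsymbol{z}_h=(z_{h,1},\ldots,z_{h,s})\in G^s$ with $z_{h,j}^{\top}=C_j(\eta_0,\ldots,\eta_{m-1})^{\top}$ (computed over $\mathbb{Z}_b$). The digital net over $\mathbb{Z}_b$ in $G^s$ with generating matrices $C_1,\ldots,C_s$ is $\mathcal{P}=\{\boldsymbol{z}_0,\ldots,\boldsymbol{z}_{b^m-1}\}$ (so $|\mathcal{P}|=b^m$). Dual net: for $k\in\mathbb{N}_0$ with finite $b$-adic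 expansion $k=\kappa_0+\kappa_1b+\cdots$, write $\vec{k}=(\kappa_0,\kappa_1,\ldots)$. Then $\mathcal{P}^{\perp}=\{\boldsymbol{k}=(k_1,\ldots,k_s)\in\mathbb{N}_0^s:\vec{k}_1C_1\oplus\cdots\oplus\vec{k}_sC_s=(0,\ldots,0)\in\mathbb{Z}_b^m\}$. $b$-adic antithetic sampling: for $l\in\mathbb{Z}_b$ let $e_l=(l,l,\ldots)\in G$ and $\boldsymbol{e}_l=(e_l,\ldots,e_l)\in G^s$. Then $\mathcal{P}_{b\text{-}\mathrm{ant}}=\bigcup_{l\in\mathbb{Z}_b}\{\boldsymbol{z}\oplus\boldsymbol{e}_l:\boldsymbol{z}\in\mathcal{P}\}$, with multiplicity, so $|\mathcal{P}_{b\text{-}\mathrm{ant}}|=b|\mathcal{P}|$. Sum of digits modulo $b$: $\delta(k)=\sum_{i\ge0}\kappa_i \bmod b$ for $k=\sum_i\kappa_ib^i\in\mathbb{N}_0$, and $\delta(\boldsymbol{k})=\sum_{j=1}^s\delta(k_j)\bmod b$ for $\boldsymbol{k}\in\mathbb{N}_0^s$. Integration: $I(f)=\int_{[0,1]^s}f(\boldsymbol{x})\,d\boldsymbol{x}$ and $I(f;P)=\frac1{|P|}\sum_{\boldsymbol{x}\in P}f(\boldsymbol{x})$ (sum with multiplicity). Walsh functions and coefficients: each $x\in[0,1]$ is written $x=\xi_1/b+\xi_2/b^2+\cdots$ with $\xi_i\in\{0,\ldots,b-1\}$, infinitely many $\xi_i\ne b-1$ if $x\in[0,1)$, and all $\xi_i=b-1$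 if $x=1$. For $k=\kappa_0+\kappa_1b+\cdots\in\mathbb{N}_0$, $\mathrm{wal}_k(x)=\omega_b^{\kappa_0\xi_1+\kappa_1\xi_2+\cdots}$; for $\boldsymbol{k}\in\mathbb{N}_0^s$, $\mathrm{wal}_{\boldsymbol{k}}(\boldsymbol{x})=\prod_{j=1}^s\mathrm{wal}_{k_j}(x_j)$; and $\hat f(\boldsymbol{k})=\int_{[0,1]^s}f(\boldsymbol{x})\overline{\mathrm{wal}_{\boldsymbol{k}}(\boldsymbol{x})}\,d\boldsymbol{x}$. *)

(* Defs.v *)
(* This development uses MathComp-Analysis, over an arbitrary R : realType. *)
From HB Require Import structures.
From mathcomp Require Import all_boot all_order all_algebra.
From mathcomp Require Import finmap complex.
From mathcomp Require Import all_classical all_reals all_analysis.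
From mathcomp.analysis.showcase Require summability.
Set Implicit Arguments.
Unset Strict Implicit.
Unset Printing Implicit Defensive.
Import Order.TTheory GRing.Theory Num.Theory.
Import numFieldNormedType.Exports.
Local Open Scope classical_set_scope.
Local Open Scope ring_scope.

(* s-dimensional Lebesgue measure.  The library has the product sigma-algebra
   on n-tuples but no n-fold product measure; it is built here by recursion,
   as the image of the binary product under cons. *)
Section lebesgue_tuple.
Variable R : realType.
Local Notation mR := (measurableTypeR R).

Definition tcons n (x : mR * n.-tuple mR) : n.+1.-tuple mR :=
  [tuple of x.1 :: x.2].

Lemma measurable_tcons n : measurable_fun [set: mR * n.-tuple mR] (@tcons n).
Proof. exact: measurable_cons. Qed.

HB.instance Definition _ n := isMeasurableFun.Build _ _ _ _ (@tcons n)
  (@measurable_tcons n).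

Section step.
Variables (n : nat) (mu : {sigma_finite_measure set (n.-tuple mR) -> \bar R}).

Definition lebesgue_step : set (n.+1.-tuple mR) -> \bar R :=
  pushforward (@lebesgue_measure R \x mu)%E (@tcons n).

Let lebesgue_step0 : lebesgue_step set0 = 0%E.
Proof. by rewrite /lebesgue_step /pushforward preimage_set0 measure0. Qed.

Let lebesgue_step_ge0 A : (0 <= lebesgue_step A)%E.
Proof. exact: measure_ge0. Qed.

Let lebesgue_step_sigma_additive : semi_sigma_additive lebesgue_step.
Proof.
exact: (@measure_semi_sigma_additive _ _ _ (pushforward _ (@tcons n))).
Qed.

HB.instance Definition _ := isMeasure.Build _ _ _ lebesgue_step
  lebesgue_step0 lebesgue_step_ge0 lebesgue_step_sigma_additive.

Let lebesgue_step_sigma_finite : sigma_finite setT lebesgue_step.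
Proof.
have /sigma_finiteP[F [TF ndF Foo]] := sigma_finiteT (@lebesgue_measure R).
have /sigma_finiteP[G [TG ndG Goo]] := sigma_finiteT mu.
pose g (t : n.+1.-tuple mR) : mR * n.-tuple mR :=
  (tnth t ord0, [tuple of behead t]).
have mg : measurable_fun setT g.
  apply/measurable_fun_pairP; split; first exact: measurable_tnth.
  exact: measurable_behead.
have tK : g \o @tcons n = idfun.
  apply/funext => -[a t]; rewrite /g /tcons /=; congr pair; exact: val_inj.
exists (fun i => g @^-1` (F i `*` G i)).
  rewrite -preimage_bigcup (_ : \bigcup_i _ = setT) ?preimage_setT//.
  rewrite -setXTT TF TG predeqE => -[x y]; split.
    by move=> [i _ []/= ? ?]; split; exists i.
  move=> [/= [i _ Fix] [k _ Gky]]; exists (maxn i k) => //; split.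
  - by move: x Fix; exact/subsetPset/ndF/leq_maxl.
  - by move: y Gky; exact/subsetPset/ndG/leq_maxr.
move=> k; have [mF Fk] := Foo k; have [mG Gk] := Goo k; split.
  by rewrite -[X in measurable X]setTI; apply: mg => //; exact: measurableX.
rewrite /lebesgue_step /pushforward -comp_preimage tK preimage_id.
by rewrite product_measure1E// lte_mul_pinfty// ge0_fin_numE.
Qed.

HB.instance Definition _ := Measure_isSigmaFinite.Build _ _ _ lebesgue_step
  lebesgue_step_sigma_finite.
End step.

Fixpoint lebesgue_tuple n : {sigma_finite_measure set (n.-tuple mR) -> \bar R} :=
  if n is n'.+1 then lebesgue_step (lebesgue_tuple n')
  else @dirac _ (0.-tuple mR) [tuple] R.

End lebesgue_tuple.

Section integration.
Variables (R : realType) (s : nat).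

Definition cube : set 'rV[R]_s := [set x | forall j, 0 <= x ord0 j <= 1].

Definition row_of_tuple (t : s.-tuple (measurableTypeR R)) : 'rV[R]_s :=
  \row_j tnth t j.

Definition cube_integral (g : 'rV[R]_s -> R) : R :=
  \int[lebesgue_tuple R s]_(t in row_of_tuple @^-1` cube) g (row_of_tuple t).

Definition cube_cintegral (g : 'rV[R]_s -> R[i]) : R[i] :=
  (cube_integral (fun x => complex.Re (g x)) +i*
   cube_integral (fun x => complex.Im (g x)))%C.

Definition sample_mean (I : finType) (P : I -> 'rV[R]_s) (f : 'rV[R]_s -> R) :
  R := (#|I|%:R)^-1 * \sum_(i : I) f (P i).

End integration.

(* kappa_i in k = kappa_0 + kappa_1 b + kappa_2 b^2 + ...  For 1 < b one has
   k < b ^ k, so kappa_i = 0 for i >= k: the sums over all digits of k below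
   are written as sums over i < k. *)
Definition digit (b k i : nat) : nat := (k %/ b ^ i) %% b.

(* G is the type nat -> 'Z_b, with zeta_(i+1) stored at index i, and a point of
   G^s is a function 'I_s -> nat -> 'Z_b.  The type 'Z_b is the ring of integers
   modulo b only for 1 < b. *)
Section nets.
Variables b s m : nat.

Definition digital_net (C : 'I_s -> nat -> 'I_m -> 'Z_b) (h : 'I_(b ^ m)) :
  'I_s -> nat -> 'Z_b :=
  fun j i => \sum_(r < m) C j i r * (digit b h r)%:R.

Definition dual_net (C : 'I_s -> nat -> 'I_m -> 'Z_b) :
  set {ffun 'I_s -> nat} :=
  [set k | forall r : 'I_m,
     \sum_(j < s) \sum_(i < k j) (digit b (k j) i)%:R * C j i r = 0].

Definition badic_antithetic (I : finType) (P : I -> 'I_s -> nat -> 'Z_b) :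
  'Z_b * I -> 'I_s -> nat -> 'Z_b :=
  fun lz j i => P lz.2 j i + lz.1.

Definition digit_sum (k : nat) : 'Z_b := \sum_(i < k) (digit b k i)%:R.

Definition digit_sums (k : {ffun 'I_s -> nat}) : 'Z_b :=
  \sum_(j < s) digit_sum (k j).

End nets.

Section walsh.
Variables (R : realType) (b : nat).

Definition proj (z : nat -> 'Z_b) : R :=
  limn (series (fun i => (z i : nat)%:R / b%:R ^+ i.+1 : R)).

Definition projs s (z : 'I_s -> nat -> 'Z_b) : 'rV[R]_s :=
  \row_j proj (z j).

Definition is_expansion (x : R) (xi : nat -> 'Z_b) : Prop :=
  [/\ x = proj xi,
      x < 1 -> infinite_set [set i | (xi i : nat) != b.-1] &
      x = 1 -> forall i, (xi i : nat) = b.-1].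

Definition expansion (x : R) : nat -> 'Z_b :=
  xget (fun=> 0) [set xi | is_expansion x xi].

Definition omega : R[i] :=
  (cos (2 * pi / b%:R) +i* sin (2 * pi / b%:R))%C.

Definition wal (k : nat) (x : R) : R[i] :=
  omega ^+ (\sum_(i < k) digit b k i * (expansion x i : nat))%N.

Definition wals s (k : {ffun 'I_s -> nat}) (x : 'rV[R]_s) : R[i] :=
  \prod_(j < s) wal (k j) (x ord0 j).

Definition walsh_coef s (f : 'rV[R]_s -> R) (k : {ffun 'I_s -> nat}) : R[i] :=
  cube_cintegral (fun x => (f x)%:C%C * ((wals k x)^*)%C).

(* Unconditional summation: the finite partial sums over A converge to S along
   the net of finite sets A ordered by inclusion.  The topology of the complex
   numbers is carried by the alias R[i]^o. *)
Definition has_sum (T : choiceType) (D : set T) (a : T -> R[i]) (S : R[i]) :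
  Prop :=
  (fun A : {fset T} => (\sum_(k <- A | k \in D) a k : R[i]^o))
    @ summability.totally --> (S : R[i]^o).

End walsh.

(* Main.v *)
(* Write F = f o pi on G^s.  Summing f^(k) wal_k(z) over all k with every
   k_j < b^n gives a Dirichlet kernel, hence the average of f over the elementary
   cell of side b^-n of the points whose expansions agree with z to n digits.
   Since that cell shrinks to pi(z), continuity gives convergence to f(pi(z)) for
   every z in G^s, including those z with eventually constant tail b-1, provided
   wal_k(z) is read as a character of G^s.  Averaging these partial sums over
   the antithetic net, orthogonality of characters leaves exactly the k in the
   dual net with delta(k) = 0; absolute summability then turns convergence along
   boxes into unconditional convergence. *)
Require Import Defs.
From mathcomp Require Import all_boot all_order all_algebra.
From mathcomp Require Import finmap complex.
From mathcomp Require Import all_classical all_reals all_analysis.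
From mathcomp.analysis.showcase Require summability.
From mathcomp Require Import ring lra.
Set Implicit Arguments.
Unset Strict Implicit.
Unset Printing Implicit Defensive.
Import Order.TTheory GRing.Theory Num.Theory.
Import numFieldNormedType.Exports.
Local Open Scope classical_set_scope.
Local Open Scope ring_scope.

(** * Digits and characters *)

Section digits.
Variable b : nat.
Hypothesis hb : (1 < b)%N.
Let b_gt0 : (0 < b)%N. Proof. exact: ltnW. Qed.

Lemma digit_small k i : (k < b ^ i)%N -> digit b k i = 0%N.
Proof. by move=> ki; rewrite /digit divn_small// mod0n. Qed.

Lemma digit_addl c k n i : (i < n)%N -> digit b (k + c * b ^ n) i = digit b k i.
Proof.
move=> lt_in; rewrite /digit addnC -(subnK lt_in) expnD expnS !mulnA.
by rewrite divnMDl ?expn_gt0 ?b_gt0// modnMDl.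
Qed.

Lemma digit_addr c k n :
  (c < b)%N -> (k < b ^ n)%N -> digit b (k + c * b ^ n) n = c.
Proof.
move=> cb kn; rewrite /digit addnC divnMDl ?expn_gt0 ?b_gt0// divn_small//.
by rewrite addn0 modn_small.
Qed.

(** Distributivity over digit strings: h below b^n runs through all strings of n digits exactly
    once. The induction splits off the leading digit c through h = k + c * b^n. *)
Lemma sum_prod_digit (A : comPzRingType) n (g : nat -> nat -> A) :
  \sum_(0 <= h < b ^ n) \prod_(i < n) g i (digit b h i) =
  \prod_(i < n) \sum_(0 <= c < b) g i c.
Proof.
elim: n => [|n IHn]; first by rewrite big_nat1 !big_ord0.
rewrite expnS big_nat_mul big_ord_recr /= -IHn mulrC big_distrl /=.
apply: eq_big_nat => c /andP[_ cb].
rewrite -{1}[(c * _)%N]add0n big_addn mulSn addnK big_distrr /=.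
apply: eq_big_nat => h /andP[_ hn].
rewrite big_ord_recr /= digit_addr// mulrC; congr (_ * _).
by apply: eq_bigr => i _; rewrite digit_addl.
Qed.

(** Trades the k-dependent range i < k of the definitions for a uniform range i < n. Both k and n
    bound the digit length, k because k < b^k, and every digit beyond that length is 0. *)
Lemma sum_digit_widen (A : nmodType) (g : nat -> nat -> A) k n :
  (forall i, g i 0%N = 0) -> (k < b ^ n)%N ->
  \sum_(i < k) g i (digit b k i) = \sum_(i < n) g i (digit b k i).
Proof.
move=> g0 kn; have kk : (k < b ^ k)%N by exact: ltn_expl.
have tail p q : (k < b ^ p)%N -> (p <= q)%N ->
    \sum_(i < q) g i (digit b k i) = \sum_(i < p) g i (digit b k i).
  move=> kp pq; rewrite -!(big_mkord xpredT (fun i => g i (digit b k i))).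
  rewrite (big_cat_nat _ pq)//= [X in _ + X]big_nat_cond [X in _ + X]big1 ?addr0// => i.
  rewrite andbT => /andP[pi _]; rewrite digit_small ?g0//.
  by apply: leq_trans kp _; rewrite leq_exp2l.
by have [le_kn|/ltnW le_nk] := leqP k n; [rewrite (tail k n)|rewrite -(tail n k)].
Qed.

End digits.

(** * Characters of Z_b and their orthogonality *)

Section characters.
Variables (R : realType) (b : nat).
Hypothesis hb : (1 < b)%N.
Let b_gt0 : (0 < b)%N. Proof. exact: ltnW. Qed.
Local Notation omega := (omega R b).
Local Open Scope complex_scope.

Lemma omegaX n :
  omega ^+ n = cos (2 * pi / b%:R * n%:R) +i* sin (2 * pi / b%:R * n%:R).
Proof.
elim: n => [|n IHn]; first by rewrite expr0 mulr0 cos0 sin0.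
rewrite exprS IHn -[n.+1%:R]natr1 (mulrDr (2 * pi / b%:R)) mulr1 cosD sinD.
set t := 2 * pi / b%:R * n%:R; rewrite /Defs.omega.
set u := 2 * pi / b%:R; congr (_ +i* _).
  by rewrite ![cos u * _]mulrC ![sin u * _]mulrC.
by rewrite ![cos u * _]mulrC ![sin u * _]mulrC.
Qed.

Lemma omega_expb : omega ^+ b = 1.
Proof.
rewrite omegaX -mulrA mulVf ?pnatr_eq0 -?lt0n 1?ltnW// mulr1.
by rewrite mulr_natl cos2pi sin2pi.
Qed.

(** Real parts suffice: with t = pi v / b strictly between 0 and pi, cos (2 t) = 1 - 2 sin^2 t <
    1. *)
Lemma omega_neq1 v : (0 < v < b)%N -> omega ^+ v != 1.
Proof.
move=> /andP[v0 vb]; rewrite omegaX eq_complex /= negb_and; apply/orP; left.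
have b0 : 0 < b%:R :> R by rewrite ltr0n (leq_trans v0)// ltnW.
set t := pi / b%:R * v%:R : R.
have -> : 2 * pi / b%:R * v%:R = t *+ 2.
  by rewrite -(mulr_natl t) /t !mulrA.
have st : 0 < sin t.
  apply: sin_gt0_pi; rewrite /t mulr_gt0 ?divr_gt0 ?pi_gt0 ?ltr0n//=.
  by rewrite -mulrA gtr_pMr ?pi_gt0// ltr_pdivrMl// mulr1 ltr_nat.
rewrite cos_mulr2n cos2sin2 lt_eqF//; have := exprn_gt0 2 st; lra.
Qed.

Definition chi (v : 'Z_b) : R[i] := omega ^+ (v : nat).

Lemma chi_nat n : chi n%:R = omega ^+ n.
Proof. by rewrite /chi val_Zp_nat// expr_mod// omega_expb. Qed.

Lemma chi0 : chi 0 = 1.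
Proof. by rewrite /chi expr0. Qed.

Lemma chiD v w : chi (v + w) = chi v * chi w.
Proof.
by rewrite -[v in LHS]natr_Zp -[w in LHS]natr_Zp -natrD chi_nat exprD.
Qed.

Lemma chi_sum (I : Type) (r : seq I) (P : pred I) (v : I -> 'Z_b) :
  chi (\sum_(i <- r | P i) v i) = \prod_(i <- r | P i) chi (v i).
Proof. exact: (big_morph _ chiD chi0). Qed.

Lemma chiMn v n : chi (v *+ n) = chi v ^+ n.
Proof. by elim: n => [|n IHn]; rewrite ?chi0// mulrS exprS chiD IHn. Qed.

(** Both sides are inverse to [chi v], the left one because cos^2 + sin^2 = 1. *)
Lemma chi_conj v : ((chi v)^*)%C = chi (- v).
Proof.
have chi_neq0 : chi v != 0.
  apply: contra_eq_neq (chiD v (- v)) => ->.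
  by rewrite subrr chi0 mul0r oner_neq0.
apply: (mulIf chi_neq0); rewrite -chiD addNr chi0 /chi omegaX.
set t := 2 * pi / b%:R * v%:R; rewrite -[RHS]/(1%:C) -(cos2Dsin2 t).
apply/eqP; rewrite eq_complex /=; apply/andP; split; apply/eqP.
  ring.
ring.
Qed.

(** A geometric sum: for v nonzero, multiplying by [chi v - 1] gives chi (b v) - 1 = 0, and [chi v]
    differs from 1 by [omega_neq1], whether or not b is prime. *)
Lemma sum_chi v : \sum_(0 <= c < b) chi (c%:R * v) = (v == 0)%:R * b%:R.
Proof.
rewrite (eq_bigr (fun c => chi v ^+ c)); last first.
  by move=> c _; rewrite mulr_natl chiMn.
have [->|v0] := eqVneq v 0.
  rewrite mul1r (eq_bigr (fun=> 1)) => [|c _]; last by rewrite chi0 expr1n.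
  by rewrite big_const_nat subn0 iter_addr_0.
have chi1 : chi v - 1 != 0.
  rewrite subr_eq0 omega_neq1// lt0n; apply/andP; split.
    by apply: contra_neq v0 => v0; exact: val_inj.
  by rewrite -[X in (_ < X)%N](Zp_cast hb).
apply: (mulfI chi1); rewrite big_mkord -subrX1 -chiMn mul0r mulr0.
by rewrite -mulr_natr pchar_Zp// mulr0 chi0 subrr.
Qed.

Lemma sum_chi_digits n (v : 'I_n -> 'Z_b) :
  \sum_(h < b ^ n) chi (\sum_(i < n) (digit b h i)%:R * v i) =
  [forall i, v i == 0]%:R * (b ^ n)%:R.
Proof.
(* The case n = 0 is separate because [inord] below needs the nonempty index type 'I_n.+1. *)
case: n v => [|n] v.
  rewrite big_ord1 big_ord0 chi0 mulr1.
  by case: forallP => // h; case: h => -[].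
rewrite -(big_mkord xpredT
  (fun h => chi (\sum_(i < n.+1) (digit b h i)%:R * v i))).
rewrite (eq_bigr (fun h => \prod_(i < n.+1)
    (fun i c => chi (c%:R * v (inord i))) i (digit b h i))); last first.
  by move=> h _; rewrite chi_sum; apply: eq_bigr => i _; rewrite inord_val.
rewrite (sum_prod_digit hb _ (fun i c => chi (c%:R * v (inord i)))).
rewrite (eq_bigr (fun i => (v i == 0)%:R * b%:R)); last first.
  by move=> i _; rewrite sum_chi inord_val.
rewrite big_split /= prodr_const card_ord natrX; congr (_ * _).
have [/forallP v0|] := boolP [forall i, v i == 0].
  by rewrite big1// => i _; rewrite v0.
by rewrite negb_forall => /existsP[i /negPf vi]; rewrite (bigD1 i)//= vi mul0r.
Qed.

(** * Walsh functions on G^s: sums over the antithetic net and the Dirichlet kernel *)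

Section walsh_group.
Variable s : nat.
Implicit Types (k : {ffun 'I_s -> nat}) (z w : 'I_s -> nat -> 'Z_b).

(* The k-th Walsh function as a character of the group G^s; unlike wals it does
   not identify the two expansions of a b-adic rational. *)
Definition walG k z : R[i] :=
  chi (\sum_(j < s) \sum_(i < k j) (digit b (k j) i)%:R * z j i).

Lemma walsE k (x : 'rV[R]_s) :
  wals b k x = walG k (fun j => expansion b (x ord0 j)).
Proof.
rewrite /wals /walG chi_sum; apply: eq_bigr => j _.
rewrite /wal -chi_nat natr_sum; congr chi; apply: eq_bigr => i _.
by rewrite natrM natr_Zp.
Qed.

(** At the point given by the shift l and the index h, the character splits into a factor in l and a
    factor in the digits of h. Summing over l detects that the digit sum of k vanishes; summing over
    h detects the dual net. *)
Lemma sum_walG_net m (C : 'I_s -> nat -> 'I_m -> 'Z_b) k :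
  \sum_(p : 'Z_b * 'I_(b ^ m)) walG k (badic_antithetic (digital_net C) p) =
  (`[< dual_net C k /\ digit_sums b k = 0 >])%:R * #|{: 'Z_b * 'I_(b ^ m)}|%:R.
Proof.
(* [v r] is the r-th entry of the row vector k_1 C_1 + ... + k_s C_s, so k is in the dual net iff v
   = 0. *)
pose v r := \sum_(j < s) \sum_(i < k j) (digit b (k j) i)%:R * C j i r.
have walGE (p : 'Z_b * 'I_(b ^ m)) :
    walG k (badic_antithetic (digital_net C) p) =
    chi ((p.1 : nat)%:R * digit_sums b k) *
    chi (\sum_(r < m) (digit b p.2 r)%:R * v r).
  rewrite -chiD; congr chi.
  under eq_bigr => j _ do under eq_bigr => i _ do
    rewrite /badic_antithetic mulrDr.
  under eq_bigr => j _ do rewrite big_split /=.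
  rewrite big_split /= addrC; congr (_ + _).
    rewrite natr_Zp /digit_sums big_distrr /=; apply: eq_bigr => j _.
    by rewrite big_distrr /=; apply: eq_bigr => i _; rewrite mulrC.
  under eq_bigr => j _ do (under eq_bigr => i _ do
    rewrite /digital_net big_distrr /=).
  under eq_bigr => j _ do rewrite exchange_big /=.
  rewrite exchange_big /=; apply: eq_bigr => r _.
  rewrite big_distrr /=; apply: eq_bigr => j _.
  rewrite big_distrr /=; apply: eq_bigr => i _.
  by rewrite mulrA mulrC mulrA.
under eq_bigr => p _ do rewrite walGE.
rewrite -(pair_big xpredT xpredT (fun (l : 'Z_b) (h : 'I_(b ^ m)) =>
  chi ((l : nat)%:R * digit_sums b k) *
    chi (\sum_(r < m) (digit b h r)%:R * v r)))/=.
rewrite -big_distrlr /= sum_chi_digits.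
rewrite -(big_mkord xpredT (fun l => chi (l%:R * digit_sums b k))).
rewrite [X in index_iota _ X]Zp_cast// sum_chi.
rewrite card_prod !card_ord [X in _ = _ * (X * _)%:R]Zp_cast// mulrACA -!natrM mulnb.
congr ((nat_of_bool _ * _)%:R); apply/idP/asboolP.
  by move=> /andP[/eqP d0 /forallP dk]; split=> // r; apply/eqP/dk.
by move=> [dk ->]; rewrite eqxx /=; apply/forallP => r; apply/eqP/dk.
Qed.

(** The Dirichlet kernel: each term is the character at z - w, so the sum factors over the
    coordinates and [sum_chi_digits] applies to each of them. *)
Lemma sum_walG_conj n z w :
  \sum_(k : {ffun 'I_s -> 'I_(b ^ n)})
    walG [ffun j => (k j : nat)] z * ((walG [ffun j => (k j : nat)] w)^*)%C =
  [forall j, forall i : 'I_n, z j i == w j i]%:R * (b ^ (n * s))%:R.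
Proof.
pose F j (h : 'I_(b ^ n)) :=
  chi (\sum_(i < n) (digit b h i)%:R * (z j i - w j i)).
rewrite (eq_bigr (fun k : {ffun 'I_s -> 'I_(b ^ n)} => \prod_j F j (k j)));
  last first.
  move=> k _; rewrite chi_conj -chiD -sumrB chi_sum; apply: eq_bigr => j _.
  rewrite /F ffunE -sumrB; congr chi.
  rewrite -(@sum_digit_widen _ hb _ (fun i c => c%:R * (z j i - w j i))) ?ltn_ord//.
    by apply: eq_bigr => i _; rewrite mulrBr.
  by move=> i; rewrite mul0r.
rewrite -(bigA_distr_bigA F)/=.
under eq_bigr => j _ do rewrite sum_chi_digits.
rewrite big_split /= prodr_const card_ord expnM (natrX _ (b ^ n)); congr (_ * _).
have [/forallP zw|] := boolP [forall j, forall i : 'I_n, z j i == w j i].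
  rewrite big1// => j _; case: forallP => // -[] i.
  by rewrite subr_eq0 (forallP (zw j)).
rewrite negb_forall => /existsP[j zw]; rewrite (bigD1 j)//=.
case: forallP => [zw0|]; last by rewrite mul0r.
by case/negP: zw; apply/forallP => i; rewrite -subr_eq0.
Qed.

End walsh_group.
End characters.

(** * Base-b expansions and elementary cells *)

Section expansions.
Variables (R : realType) (b : nat).
Hypothesis hb : (1 < b)%N.
Implicit Types (z w : nat -> 'Z_b) (x : R) (n : nat).

Local Notation width n := ((b%:R : R) ^- n).
Local Notation proj := (@Defs.proj R b).

Let b_gt0 : 0 < b%:R :> R. Proof. by rewrite ltr0n ltnW. Qed.

Let width_gt0 n : 0 < width n. Proof. by rewrite invr_gt0 exprn_gt0. Qed.

Let width_split n : width n = b%:R * width n.+1.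
Proof. by rewrite exprS invfM mulrA divff ?mul1r// gt_eqF. Qed.

Lemma cvg_width : width n @[n --> \oo] --> (0 : R).
Proof.
under eq_fun do rewrite -exprVn; apply: cvg_expr.
by rewrite ger0_norm ?invr_ge0 ?ltW// invf_lt1// (ltr_nat _ 1).
Qed.

(** Besides being the partial sums behind [proj], these are the left endpoints of the nested
    elementary intervals of z; the right endpoints are [psum z n + width n]. *)
Definition psum z : nat -> R :=
  series (fun i => (z i : nat)%:R / b%:R ^+ i.+1 : R).

Lemma psum0 z : psum z 0 = 0.
Proof. by rewrite /psum /series /= big_geq. Qed.

Lemma psumS z n : psum z n.+1 = psum z n + (z n : nat)%:R * width n.+1.
Proof. by rewrite /psum /series /= big_nat_recr. Qed.

Lemma digit_leq (v : 'Z_b) : (v <= b.-1)%N.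
Proof. by rewrite -ltnS prednK ?(ltnW hb)// -[X in (_ < X)%N](Zp_cast hb). Qed.

Lemma psum_nondecreasing z : nondecreasing_seq (psum z).
Proof.
apply/nondecreasing_seqP => n; rewrite psumS lerDl mulr_ge0 ?ler0n// ltW.
Qed.

(** The right endpoint moves left by as much as the digit [z n] falls short of b - 1, hence stays
    put exactly at a digit b - 1. *)
Let upperS z n : psum z n.+1 + width n.+1 =
  psum z n + width n - (b.-1 - z n)%:R * width n.+1.
Proof.
rewrite psumS [width n]width_split natrB ?digit_leq//.
rewrite -[in b%:R](prednK (ltnW hb)) -natr1; ring.
Qed.

Lemma psumD_nonincreasing z :
  {homo (fun n => psum z n + width n) : n m / (n <= m)%N >-> m <= n}.
Proof.
apply/nonincreasing_seqP => n; rewrite upperS gerBl mulr_ge0 ?ler0n// ltW.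
Qed.

Lemma is_cvg_psum z : cvgn (psum z).
Proof.
apply: nondecreasing_is_cvgn; first exact: psum_nondecreasing.
exists (psum z 0 + width 0) => _ [n _ <-].
by rewrite (le_trans _ (psumD_nonincreasing z (leq0n n)))// lerDl ltW.
Qed.

Lemma psum_le_proj z n : psum z n <= proj z.
Proof.
exact: (nondecreasing_cvgn_le (@psum_nondecreasing z) (@is_cvg_psum z)).
Qed.

Lemma proj_le_psumD z n : proj z <= psum z n + width n.
Proof.
have cvgu : psum z m + width m @[m --> \oo] --> proj z.
  by rewrite -[proj z]addr0; apply: cvgD; [exact: is_cvg_psum|exact: cvg_width].
rewrite -(cvg_lim _ cvgu)//.
apply: (nonincreasing_cvgn_ge (@psumD_nonincreasing z)).
by apply/cvg_ex; exists (proj z).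
Qed.

Lemma proj_lt_psumD z n :
  (exists2 i, (n <= i)%N & (z i : nat) != b.-1) ->
  proj z < psum z n + width n.
Proof.
move=> [i ni zi]; apply: le_lt_trans (proj_le_psumD z i.+1) _.
apply: lt_le_trans (psumD_nonincreasing z ni).
rewrite upperS gtrBl mulr_gt0// ltr0n subn_gt0.
by rewrite ltn_neqAle zi digit_leq.
Qed.

Lemma proj_unique z x :
  (forall n, psum z n <= x <= psum z n + width n) -> proj z = x.
Proof.
move=> zx; apply: cvg_lim => //.
apply: (@squeeze_cvgr _ _ _ _ (fun n => x - width n) (cst x)).
- by near=> n; have /andP[] := zx n; rewrite lerBlDr => -> ->.
- by rewrite -[X in _ --> X]subr0; apply: cvgB; [exact: cvg_cst|exact: cvg_width].
- exact: cvg_cst.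
Unshelve. all: by end_near. Qed.

Lemma proj_itv01 z : 0 <= proj z <= 1.
Proof.
rewrite -{1}(psum0 z) psum_le_proj/=; apply: le_trans (proj_le_psumD z 0) _.
by rewrite psum0 add0r expr0 invr1.
Qed.

(** The first n digits read as an integer with [z 0] most significant, so that endpoints become
    integer multiples of b^-n and intervals can be compared in nat. *)
Fixpoint prefix_num z n : nat :=
  if n is n'.+1 then (prefix_num z n' * b + z n')%N else 0%N.

Lemma psumE z n : psum z n = (prefix_num z n)%:R * width n.
Proof.
elim: n => [|n IHn]; first by rewrite psum0 mul0r.
by rewrite psumS IHn /= natrD natrM [width n]width_split; ring.
Qed.

Lemma psumDE z n : psum z n + width n = (prefix_num z n).+1%:R * width n.
Proof. by rewrite psumE -natr1 mulrDl mul1r. Qed.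

Lemma prefix_num_inj z w n :
  prefix_num z n = prefix_num w n -> forall i, (i < n)%N -> z i = w i.
Proof.
have zlt (v : 'Z_b) : (v < b)%N by rewrite -[X in (_ < X)%N](Zp_cast hb).
elim: n => // n IHn /= zw i; rewrite ltnS leq_eqVlt => /predU1P[->|].
  apply: val_inj; move/(congr1 (modn^~ b)): zw.
  by rewrite !modnMDl !modn_small.
apply: IHn; move/(congr1 (divn^~ b)): zw.
by rewrite !divnMDl ?(ltnW hb)// !divn_small// !addn0.
Qed.

Lemma prefix_num_lt z n : (prefix_num z n < b ^ n)%N.
Proof.
elim: n => //= n IHn.
have zb : (z n < b)%N by rewrite -[X in (_ < X)%N](Zp_cast hb).
rewrite expnSr; apply: leq_trans (leq_mul IHn (leqnn b)).
by rewrite mulSn addnC ltn_add2r.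
Qed.

Lemma eq_psum z w n : (forall i, (i < n)%N -> z i = w i) -> psum z n = psum w n.
Proof. by move=> zw; apply: eq_big_nat => i /andP[_ /zw ->]. Qed.

(** Half-open grid intervals with integer indices p and q that share a point satisfy p < q + 1 and q
    < p + 1, so p = q. *)
Lemma psum_cell_inj z w n x :
  psum z n <= x < psum z n + width n -> psum w n <= x < psum w n + width n ->
  forall i, (i < n)%N -> z i = w i.
Proof.
rewrite !psumDE !psumE => /andP[zx xz] /andP[wx xw]; apply: prefix_num_inj.
have := le_lt_trans zx xw; have := le_lt_trans wx xz.
rewrite !ltr_pM2r// !ltr_nat !ltnS => wz zw.
by apply/eqP; rewrite eqn_leq wz zw.
Qed.

(** The cast into 'Z_b performs the reduction modulo b of floor (b^(i+1) x). *)
Let floor_digits x : nat -> 'Z_b :=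
  fun i => (Num.truncn (b%:R ^+ i.+1 * x))%:R.

Let prefix_num_floor_digits x n : 0 <= x < 1 ->
  prefix_num (floor_digits x) n = Num.truncn (b%:R ^+ n * x).
Proof.
move=> /andP[x0 x1]; elim: n => [|n /= ->].
  by rewrite /= expr0 mul1r; apply/esym/truncn_def; rewrite x0.
rewrite /floor_digits val_Zp_nat//.
have y0 : 0 <= b%:R ^+ n * x by rewrite mulr_ge0// exprn_ge0// ltW.
rewrite exprS -mulrA; set y := b%:R ^+ n * x in y0 *.
have by0 : 0 <= b%:R * y by rewrite mulr_ge0// ltW.
rewrite [RHS](divn_eq _ b); congr (_ * _ + _)%N.
(* The integer quotient of floor (b y) by b is floor y. *)
apply: truncn_def; rewrite -(ler_pM2l b_gt0) -(ltr_pM2l b_gt0) -!natrM.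
have /andP[lo hi] := truncn_itv by0; apply/andP; split.
  by apply: le_trans lo; rewrite ler_nat mulnC leq_divM.
apply: lt_le_trans hi _; rewrite ler_nat mulnC.
by rewrite ltn_ceil// ltnW.
Qed.

Lemma is_expansion_exists x :
  0 <= x <= 1 -> exists xi : nat -> 'Z_b, is_expansion x xi.
Proof.
move=> /andP[x0]; rewrite le_eqVlt => /predU1P[->|x1].
  exists (fun=> (b.-1)%:R).
  have v : ((b.-1)%:R : 'Z_b) = b.-1 :> nat.
    by rewrite val_Zp_nat// modn_small// prednK// ltnW.
  split=> [||_ i]; [|by rewrite ltxx|exact: v].
  apply/esym/proj_unique => n; rewrite (_ : psum _ n = 1 - width n).
    by rewrite subrK lexx andbT gerBl ltW.
  elim: n => [|n IHn]; first by rewrite psum0 expr0 invr1 subrr.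
  rewrite psumS IHn v [width n]width_split -[in b%:R](prednK (ltnW hb)) -natr1.
  by rewrite /=; ring.
set d := floor_digits x.
have cell n : psum d n <= x < psum d n + width n.
  have y0 : 0 <= b%:R ^+ n * x by rewrite mulr_ge0// exprn_ge0// ltW.
  rewrite psumDE psumE !prefix_num_floor_digits ?x0 ?x1//.
  rewrite ler_pdivrMr ?exprn_gt0// ltr_pdivlMr ?exprn_gt0// (mulrC x).
  exact: truncn_itv.
have dx : proj d = x.
  by apply: proj_unique => n; have /andP[-> /ltW ->] := cell n.
exists d; split => //; last by move=> x1'; rewrite x1' ltxx in x1.
(* Suppose only finitely many digits differ from b - 1, and let n exceed all their positions. The
   right endpoint is then constant from n on. As x lies strictly below it, some later left endpoint,
   being only b^-(n+k) away from it, exceeds x: a contradiction. *)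
move=> _ /finite_fsetP[X dX]; pose n := (\max_(i <- X) i).+1.
have tail i : (n <= i)%N -> (d i : nat) = b.-1.
  move=> ni; apply/eqP/negP => /negP di.
  have iX : i \in X by move/seteqP: dX => [/(_ i) + _]; apply.
  by have := leq_trans ni (@leq_bigmax_seq _ (enum_fset X) xpredT id i iX isT); rewrite ltnn.
have cst_upper k : psum d (n + k) + width (n + k) = psum d n + width n.
  elim: k => [|k IHk]; first by rewrite addn0.
  by rewrite addnS upperS tail ?leq_addr// subnn mul0r subr0.
have /andP[_ xlt] := cell n.
have [k _ kP] : \forall k \near \oo, width k < psum d n + width n - x.
  by apply: cvgr_lt cvg_width _ _; rewrite subr_gt0.
have /kP : (k <= n + k)%N by rewrite leq_addl.
rewrite /= -(cst_upper k) ltrBrDr addrC ltrD2r ltNge.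
by have /andP[->] := cell (n + k)%N.
Qed.

Lemma expansionP x : 0 <= x <= 1 -> is_expansion x (expansion b x).
Proof. by move=> /is_expansion_exists; exact: xgetPex. Qed.

Lemma expansion_cell x z n : 0 <= x < 1 ->
  (forall i, (i < n)%N -> expansion b x i = z i) <->
  psum z n <= x < psum z n + width n.
Proof.
move=> /andP[x0 x1]; have x01 : 0 <= x <= 1 by rewrite x0 ltW.
have [ex /(_ x1) inf _] := expansionP x01.
have cell : psum (expansion b x) n <= x < psum (expansion b x) n + width n.
  rewrite {2 3}ex psum_le_proj proj_lt_psumD//.
  apply: contrapT => small; apply: inf; apply: (sub_finite_set _ (finite_II n)).
  by move=> i /= xi; rewrite ltnNge; apply/negP => ni; apply: small; exists i.
split=> [/eq_psum <- //|zx].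
exact: psum_cell_inj cell zx.
Qed.

(** Both numbers lie in one closed interval of length b^-n. Closedness admits a z with a tail of
    digits b - 1, whose projection may be the right endpoint. *)
Lemma expansion_close x z n : 0 <= x <= 1 ->
  (forall i, (i < n)%N -> expansion b x i = z i) ->
  `|proj z - x| <= width n.
Proof.
move=> x01 /eq_psum xz; have [ex _ _] := expansionP x01.
have := psum_le_proj (expansion b x) n; have := proj_le_psumD (expansion b x) n.
have := psum_le_proj z n; have := proj_le_psumD z n.
by rewrite -ex xz ler_norml; lra.
Qed.

(** Described by digits rather than endpoints, so that the cells of level n partition the whole of
    [0, 1]. *)
Definition cell z n : set R :=
  [set x | 0 <= x <= 1 /\ forall i, (i < n)%N -> expansion b x i = z i].

(* The point 1 is set apart: its expansion is the one with all digits b - 1. *)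
Let cellE z n : cell z n =
  `[psum z n, psum z n + width n[%classic `|` (cell z n `&` [set 1]).
Proof.
have upper1 : psum z n + width n <= 1.
  rewrite psumDE ler_pdivrMr ?exprn_gt0// mul1r -natrX ler_nat.
  exact: prefix_num_lt.
apply/seteqP; split => x /=; rewrite in_itv /=.
  move=> [/andP[x0 xle] h]; have [x1|xn1] := eqVneq x 1.
    by right; split=> //; split=> //; rewrite x0.
  by left; apply/expansion_cell => //; rewrite x0 lt_neqAle xn1.
move=> [xz|[]//]; have xz' := xz; case/andP: xz => zx xz.
have x01 : 0 <= x < 1.
  by rewrite (le_trans _ zx) ?(lt_le_trans xz)//= -(psum0 z) psum_nondecreasing.
split; first by case/andP: x01 => -> /ltW ->.
exact/expansion_cell.
Qed.

Let cell1_disj z n :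
  `[psum z n, psum z n + width n[%classic `&` (cell z n `&` [set 1]) = set0.
Proof.
rewrite -subset0 => x [/= + [_ x1]]; rewrite {}x1 in_itv /= => /andP[_].
rewrite ltNge psumDE ler_pdivrMr ?exprn_gt0// mul1r -natrX ler_nat.
by rewrite prefix_num_lt.
Qed.

Lemma measurable_cell z n : measurable (cell z n : set (measurableTypeR R)).
Proof.
rewrite cellE; apply: measurableU; first exact: measurable_itv.
have [c1|c1] := pselect (cell z n 1).
  rewrite (_ : _ `&` _ = [set 1]); first exact: measurable_set1.
  by apply/seteqP; split => [x []//|x ->].
by rewrite (_ : _ `&` _ = set0)// -subset0 => x [+ x1]; rewrite x1.
Qed.

Lemma lebesgue_cell z n : (@lebesgue_measure R (cell z n) = (width n)%:E)%E.
Proof.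
have m1 : measurable (cell z n `&` [set 1] : set (measurableTypeR R)).
  by apply: measurableI; [exact: measurable_cell|exact: measurable_set1].
have m2 : measurable
    (`[psum z n, psum z n + width n[%classic : set (measurableTypeR R)).
  exact: measurable_itv.
rewrite cellE (measureU _ m2 m1 (cell1_disj z n)).
rewrite (@subset_measure0 _ (measurableTypeR R) _ _ _ [set (1 : R)] m1
  (measurable_set1 _))//; last exact: lebesgue_measure_set1.
rewrite adde0; apply: etrans (lebesgue_measure_itv _) _.
by rewrite /= lte_fin ltrDl width_gt0 -EFinB addrAC subrr add0r.
Qed.

End expansions.

(** * Integration over elementary cells *)

Section boxes.
Variable R : realType.
Local Notation mR := (measurableTypeR R).

Definition box s (X : 'I_s -> set mR) : set (s.-tuple mR) :=
  [set t | forall j, X j (tnth t j)].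

Lemma measurable_box s (X : 'I_s -> set mR) :
  (forall j, measurable (X j)) -> measurable (box X).
Proof.
move=> mX; rewrite (_ : box X = \bigcap_(j in setT) ((@tnth s mR)^~ j @^-1` X j)).
  apply: fin_bigcap_measurable; first exact: finite_finset.
  move=> j _; rewrite -[_ @^-1` _]setTI; exact: (measurable_tnth j measurableT).
by apply/seteqP; split => [t tX j _|t tX j]; apply: tX.
Qed.

Lemma lebesgue_box s (X : 'I_s -> set mR) :
  (forall j, measurable (X j)) ->
  (lebesgue_tuple R s (box X) = \prod_(j < s) @lebesgue_measure R (X j))%E.
Proof.
elim: s X => [|s IHs] X mX.
  rewrite big_ord0 /= diracE mem_set//.
  by move=> [].
rewrite big_ord_recl /= /lebesgue_step /pushforward.
rewrite (_ : _ @^-1` _ = X ord0 `*` box (fun j => X (lift ord0 j))).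
  rewrite product_measure1E//; last exact: measurable_box.
  by rewrite -IHs.
apply/seteqP; split => [[x t] /= Xt|[x t] /= [Xx Xt] j].
  split; first by have := Xt ord0; rewrite (tnth_nth x).
  move=> j; have := Xt (lift ord0 j).
  by rewrite !(tnth_nth x).
case: (unliftP ord0 j) => [i ->|->]; last by rewrite (tnth_nth x).
by have := Xt i; rewrite !(tnth_nth x).
Qed.

End boxes.

Section cells.
Variables (R : realType) (b s : nat).
Hypothesis hb : (1 < b)%N.
Local Notation mR := (measurableTypeR R).
Local Notation mu := (lebesgue_tuple R s).
Implicit Types (z : 'I_s -> nat -> 'Z_b) (n : nat) (t : s.-tuple mR).

Definition cells z n : set (s.-tuple mR) := box (fun j => @cell R b (z j) n).

Local Notation D := (@row_of_tuple R s @^-1` @cube R s).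

Lemma cube_preimageP t : D t <-> forall j, 0 <= tnth t j <= 1.
Proof. by split => Dt j; have := Dt j; rewrite mxE. Qed.

Lemma cells_sub z n : cells z n `<=` D.
Proof. by move=> t zt; apply/cube_preimageP => j; case: (zt j). Qed.

Lemma measurable_cells z n : measurable (cells z n).
Proof. by apply: measurable_box => j; exact: measurable_cell. Qed.

Lemma lebesgue_cells z n : mu (cells z n) = ((b ^ (n * s))%:R^-1)%:E.
Proof.
rewrite lebesgue_box => [|j]; last exact: measurable_cell.
under eq_bigr => j _ do rewrite lebesgue_cell//.
rewrite prodEFin prodr_const card_ord; congr (_%:E).
by rewrite exprVn natrX exprM.
Qed.

Lemma measurable_cube : measurable D.
Proof.
rewrite (_ : D = box (fun=> `[0, 1]%classic)).
  by apply: measurable_box => j; exact: measurable_itv.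
apply/seteqP; split => t => [/cube_preimageP|] Dt; [|apply/cube_preimageP];
  by move=> j; have := Dt j; rewrite /= in_itv.
Qed.

Lemma lebesgue_cube : mu D = 1%E.
Proof.
(* A cell of level 0 prescribes no digit, so it is the whole cube. *)
rewrite (_ : D = cells (fun _ _ => 0) 0).
  by rewrite lebesgue_cells mul0n expn0 invr1.
apply/seteqP; split => t; last exact: cells_sub.
by move=> /cube_preimageP Dt j; split.
Qed.

Definition digits n t : {ffun 'I_s * 'I_n -> 'Z_b} :=
  [ffun p : 'I_s * 'I_n => expansion b (tnth t p.1) p.2].

(** Pads a digit block by 0 to a point of G^s; a cell of level n reads only the positions below
    n. *)
Definition extend n (a : {ffun 'I_s * 'I_n -> 'Z_b}) (j : 'I_s) (i : nat) :
    'Z_b :=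
  if insub i is Some i' then a (j, i') else 0.

Lemma extendE n (a : {ffun 'I_s * 'I_n -> 'Z_b}) j (i : 'I_n) :
  extend a j i = a (j, i).
Proof. by rewrite /extend valK. Qed.

Lemma cells_digits n (a : {ffun 'I_s * 'I_n -> 'Z_b}) t :
  cells (extend a) n t <-> D t /\ digits n t = a.
Proof.
split=> [at_|[/cube_preimageP Dt ta] j].
  split; first exact: cells_sub at_.
  apply/ffunP => -[j i]; rewrite ffunE /= -extendE.
  by case: (at_ j) => _; apply.
split; first exact: Dt.
by move=> i lt_in; rewrite -ta (extendE _ j (Ordinal lt_in)) ffunE.
Qed.

(** A function of the first n digits is a step function: its preimages are finite unions of
    cells. *)
Lemma measurable_digits d (T : measurableType d) n
    (h : {ffun 'I_s * 'I_n -> 'Z_b} -> T) :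
  measurable_fun D (h \o digits n).
Proof.
move=> mD Y _; rewrite (_ : _ `&` _ =
    \bigcup_(a in [set a | Y (h a)]) cells (extend a) n).
  apply: fin_bigcup_measurable; first exact: finite_finset.
  by move=> a _; exact: measurable_cells.
apply/seteqP; split => [t [Dt hY]|t [a Ya /cells_digits[Dt ta]]].
  by exists (digits n t) => //; apply/cells_digits.
by split=> //=; rewrite ta.
Qed.

End cells.

(** * Integrability and cell averages of a continuous integrand *)

Section integrand.
Variables (R : realType) (b s : nat).
Hypothesis hb : (1 < b)%N.
Variable f : 'rV[R]_s -> R.
Hypothesis hf : {within @cube R s, continuous f}.
Local Notation mR := (measurableTypeR R).
Local Notation mu := (lebesgue_tuple R s).
Local Notation D := (@row_of_tuple R s @^-1` @cube R s).
Local Notation width n := ((b%:R : R) ^- n).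
Implicit Types (z : 'I_s -> nat -> 'Z_b) (n : nat) (t : s.-tuple mR).

Lemma within_cube_continuous (p : 'rV[R]_s) : cube p -> forall e, 0 < e ->
  exists2 d, 0 < d & forall x, cube x ->
    (forall j, `|p ord0 j - x ord0 j| < d) -> `|f p - f x| < e.
Proof.
move=> cp e e0; have /cvgrPdist_lt/(_ e e0) := (subspace_continuousP _ _).1 hf p cp.
rewrite near_withinE => /nbhs_ballP[d /= d0 dP]; exists d => // x cx px.
by apply: dP => //; split=> // i j; rewrite ord1; exact: px.
Qed.

Let width_lt (e : R) : 0 < e -> \forall n \near \oo, width n < e.
Proof. by move=> e0; have /cvgr_lt/(_ _ e0) := @cvg_width R b hb. Qed.

(** On the cube [f] is the pointwise limit of step functions, namely its values at the lower corners
    of the level-n cells. *)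
Lemma measurable_integrand : measurable_fun D (f \o @row_of_tuple R s).
Proof.
pose corner n (a : {ffun 'I_s * 'I_n -> 'Z_b}) : 'rV[R]_s :=
  \row_j psum R (extend a j) n.
apply: (@measurable_realfun.measurable_fun_cvg _ _ _ _
  (fun n => (f \o @corner n) \o digits b n)).
  by move=> n; exact: measurable_digits.
move=> t Dt; apply/cvgrPdist_lt => e e0.
have [d d0 dP] := within_cube_continuous Dt e0.
have [N _ NP] := width_lt d0; exists N => // n /NP /= wd.
have cornerE j : corner n (digits b n t) ord0 j = psum R (expansion b (tnth t j)) n.
  rewrite mxE; apply: eq_psum => i lt_in.
  by rewrite (extendE _ j (Ordinal lt_in)) ffunE.
have tj j : psum R (expansion b (tnth t j)) n <= tnth t j <=
    psum R (expansion b (tnth t j)) n + width n.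
  have [ex _ _] := expansionP hb ((cube_preimageP t).1 Dt j).
  have := psum_le_proj R hb (expansion b (tnth t j)) n.
  have := proj_le_psumD R hb (expansion b (tnth t j)) n.
  by rewrite -ex => -> ->.
have t01 j : 0 <= tnth t j <= 1 by exact: (cube_preimageP t).1.
apply: dP => j; rewrite cornerE.
  rewrite -(psum0 R (expansion b (tnth t j))) psum_nondecreasing//=.
  by have /andP[+ _] := tj j; move/le_trans; apply; have /andP[] := t01 j.
rewrite mxE; apply: le_lt_trans wd; have /andP[lo hi] := tj j.
by rewrite ger0_norm ?subr_ge0// lerBlDl.
Qed.

Lemma integrand_bounded : exists M, forall t, D t -> `|f (row_of_tuple t)| <= M.
Proof.
have : compact (f @` @cube R s).
  apply: continuous_compact hf _.
  rewrite (_ : @cube R s = [set v | forall j, `[0, 1]%classic (v ord0 j)]).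
    exact: (@rV_compact R s (fun=> `[0, 1]%classic)
      (fun=> @segment_compact R 0 1)).
  by apply/seteqP; split => v cv j; have := cv j; rewrite /= in_itv.
move=> /compact_bounded[M [_ MP]]; exists (M + 1) => t Dt.
by apply: (MP (M + 1)); [rewrite ltrDl|exists (row_of_tuple t)].
Qed.

Lemma integrable_integrand n (h : {ffun 'I_s * 'I_n -> 'Z_b} -> R) :
  mu.-integrable D (EFin \o (fun t => f (row_of_tuple t) * h (digits b n t))).
Proof.
have mD := @measurable_cube R s.
apply: measurable_bounded_integrable => //.
- by rewrite [ltLHS](lebesgue_cube R s hb) ltry.
- apply: measurable_realfun.measurable_funM; first exact: measurable_integrand.
  exact: (measurable_digits hb h).
have [M MP] := integrand_bounded.
(* [h] takes finitely many values, so the sum of their absolute values bounds each of them. *)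
exists (M * \sum_a `|h a|); split; first exact: num_real.
move=> x Mx t Dt; apply: le_trans (ltW Mx); rewrite normrM.
apply: ler_pM => //; first exact: MP.
by rewrite (bigD1 (digits b n t))//= lerDl sumr_ge0.
Qed.

Lemma integrable_cells z n :
  mu.-integrable (cells z n) (EFin \o (f \o @row_of_tuple R s)).
Proof.
apply: (integrableS (@measurable_cube R s) (measurable_cells hb z n)
  (@cells_sub R b s z n)).
have := @integrable_integrand 0 (fun=> 1).
apply: eq_integrable; first exact: measurable_cube.
by move=> t _; rewrite /= mulr1.
Qed.

Definition cell_integral z n : R :=
  \int[mu]_(t in cells z n) f (row_of_tuple t).

(** The level-n cells partition the cube and the factor [h] is constant on each. With [h] a Walsh
    function, this turns Walsh coefficients into finite sums. *)
Lemma Rintegral_digits n (h : {ffun 'I_s * 'I_n -> 'Z_b} -> R) :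
  \int[mu]_(t in D) (f (row_of_tuple t) * h (digits b n t)) =
  \sum_a cell_integral (extend a) n * h a.
Proof.
pose F (a : {ffun 'I_s * 'I_n -> 'Z_b}) : set (s.-tuple mR) := cells (extend a) n.
have DF : D = \big[setU/set0]_(a <- index_enum {ffun 'I_s * 'I_n -> 'Z_b}) F a.
  rewrite -bigcup_seq; apply/seteqP; split => t.
    move=> Dt; exists (digits b n t); last exact/cells_digits.
    by rewrite /= mem_index_enum.
  by move=> [a _ /cells_sub].
have mF a : measurable (F a) by exact: measurable_cells.
have int_h := integrable_integrand h.
rewrite /Rintegral {1}DF integral_bigsetU_EFin//.
- rewrite (eq_bigr (fun a => (cell_integral (extend a) n * h a)%:E)).
    by rewrite sumEFin.
  move=> a _; have int_a := integrable_cells (extend a) n.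
  rewrite /cell_integral -(RintegralZr _ (mF a) int_a) /Rintegral fineK.
    by apply: eq_integral => t; rewrite inE => /cells_digits[_ ->].
  apply: (integrable_fin_num (mF a)).
  apply: (integrableS (@measurable_cube R s) (mF a) (@cells_sub R b s _ n)).
  exact: (integrable_integrand (fun=> h a)).
- exact: index_enum_uniq.
- by move=> a a' _ _ [t [/cells_digits[_ <-] /cells_digits[_ <-]]].
rewrite -DF; exact: (measurable_int _ int_h).
Qed.

(** The projection of z may lie outside its own cells, when z ends in digits b - 1. It is still
    within b^-n of all their points in each coordinate, and continuity at that point suffices. *)
Lemma cell_average_cvg z :
  ((b ^ (n * s))%:R * cell_integral z n) @[n --> \oo] --> f (projs R z).
Proof.
apply/cvgrPdist_le => e e0.
have pz : cube (projs R z) by move=> j; rewrite mxE; exact: proj_itv01.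
have [d d0 dP] := within_cube_continuous pz e0.
have [N _ NP] := width_lt d0; exists N => // n /NP /= wd.
have close t : cells z n t -> `|f (projs R z) - f (row_of_tuple t)| <= e.
  move=> zt; apply/ltW/dP; first exact: (cells_sub zt).
  move=> j; rewrite !mxE; apply: le_lt_trans wd; have [t01 tz] := zt j.
  exact: expansion_close.
have bn0 : 0 < (b ^ (n * s))%:R :> R by rewrite ltr0n expn_gt0 ltnW.
have mC := measurable_cells hb z n; have int_f := integrable_cells z n.
have int_c (c : R) : mu.-integrable (cells z n) (EFin \o cst c).
  apply: measurable_bounded_integrable => //.
    by rewrite [ltLHS](lebesgue_cells R hb) ltry.
  exact: bounded_cst.
have cst_int (c : R) : \int[mu]_(t in cells z n) c = c / (b ^ (n * s))%:R.
  by rewrite Rintegral_cst// [X in fine X](lebesgue_cells R hb).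
have lo : (f (projs R z) - e) / (b ^ (n * s))%:R <= cell_integral z n.
  rewrite -cst_int; apply: le_Rintegral => //; [exact: int_c|move=> t /close].
  by rewrite ler_norml => /andP[_]; lra.
have hi : cell_integral z n <= (f (projs R z) + e) / (b ^ (n * s))%:R.
  rewrite -cst_int; apply: le_Rintegral => //; [exact: int_c|move=> t /close].
  by rewrite ler_norml => /andP[+ _]; lra.
rewrite ler_pdivrMr// in lo; rewrite ler_pdivlMr// in hi.
by rewrite ler_norml mulrC; apply/andP; split; lra.
Qed.

End integrand.

(** * Unconditional summation *)

Section summation.
Variables (R : realType) (T : choiceType) (a : T -> R[i]).
Hypothesis suma : (\esum_(k in [set: T]) (Normc.normc (a k))%:E < +oo)%E.
Local Open Scope complex_scope.

Let normc_ge0 (x : R[i]) : 0 <= Normc.normc x.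
Proof. by case: x => x y; exact: sqrtr_ge0. Qed.

(** [A0] has a sum within e of the supremum, so a finite set disjoint from it cannot add e or
    more. *)
Lemma normc_tail (e : R) : 0 < e -> exists A0 : {fset T},
  forall B : {fset T}, (forall k, k \in B -> k \notin A0) ->
    \sum_(k <- B) Normc.normc (a k) < e.
Proof.
move=> e0.
have sup_fin :
    (\esum_(k in [set: T]) (Normc.normc (a k))%:E)%E \is a fin_num.
  rewrite ge0_fin_numE//; apply: esum_ge0 => k _.
  by rewrite lee_fin normc_ge0.
have sumE (A : {fset T}) : (\sum_(k \in [set` A]) (Normc.normc (a k))%:E =
    (\sum_(k <- A) Normc.normc (a k))%:E)%E.
  by rewrite -fsbig_seq// sumEFin.
have [_ [X [/finite_fsetP[A0 ->] _] <-]] := ub_ereal_sup_adherent e0 sup_fin.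
rewrite sumE => lt_sup; exists A0 => B BA0.
have : (\sum_(k \in [set` (A0 `|` B)%fset]) (Normc.normc (a k))%:E <=
    \esum_(k in [set: T]) (Normc.normc (a k))%:E)%E.
  by apply: ereal_sup_ubound; exists [set` (A0 `|` B)%fset].
rewrite sumE (big_fsetID _ (mem A0)) /=.
rewrite (_ : [fset x in A0 `|` B | x \in A0]%fset = A0); last first.
  by apply/fsetP => x; rewrite !inE /=; case: (x \in A0); rewrite ?andbF.
rewrite (_ : [fset x in A0 `|` B | x \notin A0]%fset = B); last first.
  apply/fsetP => x; rewrite !inE /=; case: (boolP (x \in B)) => [/BA0 ->|_].
    by rewrite orbT.
  by rewrite orbF andbN.
move: lt_sup.
rewrite -[ereal_sup _]/(\esum_(k in [set: T]) (Normc.normc (a k))%:E)%E.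
rewrite -(fineK sup_fin) -EFinB lte_fin lee_fin; lra.
Qed.

(** Two finite sets containing the [A0] of [normc_tail] are compared through [A0]: an arbitrary A,
    and a [K n] so late that it contains [A0] and its sum is close to S. The errors are e/2 + e/4 +
    e/4. *)
Lemma has_sum_exhaustion (D : set T) (K : nat -> {fset T}) (S : R[i]) :
  (forall k, \forall n \near \oo, k \in K n) ->
  (forall e, 0 < e -> \forall n \near \oo,
     Normc.normc (S - \sum_(k <- K n | k \in D) a k) < e) ->
  has_sum D a S.
Proof.
move=> exK limK; have totallyF := @summability.totally_filter T.
(* A positive element of R[i] has zero imaginary part, so the tolerance is a real e. *)
apply/(@cvgrPdist_lt _ R[i]^o) => -[e e'].
rewrite ltcE /= => /andP[/eqP -> e0].
have e3 : 0 < e / 2 by lra.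
have e4 : 0 < e / 4 by lra.
have [A0 A0P] := normc_tail e4.
exists A0 => // A A0A.
have tail (B : {fset T}) : (A0 `<=` B)%fset ->
    `|\sum_(k <- B | k \in D) a k - \sum_(k <- A0 | k \in D) a k| < (e / 4)%:C.
  move=> A0B; rewrite (big_fsetIDcond _ (mem A0)) /=.
  rewrite (_ : [fset x in B | x \in A0]%fset = A0); last first.
    apply/fsetP => x; rewrite !inE /= andbC; case: (boolP (x \in A0)) => //=.
    by move=> /(fsubsetP A0B).
  rewrite addrAC subrr add0r; apply: le_lt_trans (ler_norm_sum _ _ _) _.
  have := A0P [fset x in B | x \notin A0]%fset; rewrite -ltcR rmorph_sum /=.
  move=> /(_ _)/le_lt_trans; apply; last by move=> k; rewrite !inE => /andP[].
  rewrite [leLHS]big_mkcond /=; apply: ler_sum => k _; case: ifP => // _.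
  by rewrite lecR normc_ge0.
have nearK (r : seq T) : \forall n \near \oo, all (mem (K n)) r.
  elim: r => [|k r IHr]; first by apply: nearW.
  by apply: filterS2 (exK k) IHr => n /= -> ->.
have [n [nA nS]] := filter_ex (filterI (nearK A0) (limK _ e3)).
have {}nA : (A0 `<=` K n)%fset by apply/fsubsetP/allP.
have := tail _ nA; have := tail _ A0A.
set x := \sum_(k <- A | _) _; set y := \sum_(k <- K n | _) _ in nS *.
set w := \sum_(k <- A0 | _) _ => xw yw.
rewrite -ltcR in nS; rewrite -[e +i* 0]/(e%:C).
rewrite (_ : S - x = (S - y) + (y - w) - (x - w)); last by ring.
apply: le_lt_trans (ler_normB _ _) _.
rewrite [X in X%:C](_ : e = e / 2 + e / 4 + e / 4); last by field.
rewrite !rmorphD /=; apply: ltrD => //; apply: le_lt_trans (ler_normD _ _) _.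
exact: ltrD.
Qed.

End summation.

(** * Walsh series *)

Section walsh_series.
Variables (R : realType) (b s : nat).
Hypothesis hb : (1 < b)%N.
Variable f : 'rV[R]_s -> R.
Hypothesis hf : {within @cube R s, continuous f}.
Local Open Scope complex_scope.
Local Notation mR := (measurableTypeR R).
Local Notation mu := (lebesgue_tuple R s).
Local Notation D := (@row_of_tuple R s @^-1` @cube R s).
Implicit Types (z : 'I_s -> nat -> 'Z_b) (k : {ffun 'I_s -> nat}) (n : nat).

Lemma walG_prefix k z n : (forall j, (k j < b ^ n)%N) ->
  walG R k z = chi R (\sum_(j < s) \sum_(i < n) (digit b (k j) i)%:R * z j i).
Proof.
move=> kn; congr chi; apply: eq_bigr => j _.
by rewrite (@sum_digit_widen _ hb _ (fun i c => c%:R * z j i) _ n)// => i; rewrite mul0r.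
Qed.

(** When every k_j is below b^n, the Walsh function reads only the first n digits and is constant on
    each level-n cell. *)
Lemma walG_digits k n (t : s.-tuple mR) : (forall j, (k j < b ^ n)%N) ->
  wals b k (row_of_tuple t) = walG R k (extend (digits b n t)).
Proof.
move=> kn; rewrite walsE// !(walG_prefix _ kn); congr chi.
apply: eq_bigr => j _; apply: eq_bigr => i _.
by rewrite extendE ffunE mxE.
Qed.

Let sum_complex (I : finType) (F : I -> R) (w : I -> R[i]) :
  \sum_i (F i)%:C * w i =
  (\sum_i F i * complex.Re (w i)) +i* (\sum_i F i * complex.Im (w i)).
Proof.
elim/big_rec3: _ => [//|i y1 y2 y3 _ ->]; case: (w i) => p q.
by apply/eqP; rewrite eq_complex /= !mul0r subr0 addr0 !eqxx.
Qed.

Lemma walsh_coefE k n : (forall j, (k j < b ^ n)%N) ->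
  walsh_coef b f k =
  \sum_(a : {ffun 'I_s * 'I_n -> 'Z_b})
    (cell_integral f (extend a) n)%:C * ((walG R k (extend a))^*)%C.
Proof.
move=> kn; rewrite sum_complex /walsh_coef /cube_cintegral /cube_integral.
congr (_ +i* _).
  rewrite -(Rintegral_digits hb hf (fun a : {ffun 'I_s * 'I_n -> 'Z_b} =>
    complex.Re ((walG R k (extend a))^*)%C)).
  apply: eq_Rintegral => t _; rewrite -walG_digits//.
  by case: (wals _ _ _) => p q /=; rewrite mul0r subr0.
rewrite -(Rintegral_digits hb hf (fun a : {ffun 'I_s * 'I_n -> 'Z_b} =>
  complex.Im ((walG R k (extend a))^*)%C)).
apply: eq_Rintegral => t _; rewrite -walG_digits//.
by case: (wals _ _ _) => p q /=; rewrite mul0r addr0.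
Qed.

(** After exchanging sums, the Dirichlet kernel kills every digit block except that of z, where it
    equals b^(ns), the inverse volume of the cell. *)
Lemma walsh_partial_sum z n :
  \sum_(k : {ffun 'I_s -> 'I_(b ^ n)})
    walsh_coef b f [ffun j => (k j : nat)] * walG R [ffun j => (k j : nat)] z =
  ((b ^ (n * s))%:R * cell_integral f z n)%:C.
Proof.
have kn (k : {ffun 'I_s -> 'I_(b ^ n)}) j : ([ffun j => (k j : nat)] j < b ^ n)%N.
  by rewrite ffunE.
under eq_bigr => k _ do rewrite (walsh_coefE (kn k)) big_distrl /=.
rewrite exchange_big /= (bigD1 [ffun p : 'I_s * 'I_n => z p.1 p.2]) //=.
rewrite [X in _ + X]big1 ?addr0.
  under eq_bigr => k _ do rewrite -mulrA [(_^*)%C * _]mulrC.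
  rewrite -big_distrr /= sum_walG_conj//.
  have -> : [forall j, forall i : 'I_n,
      z j i == extend [ffun p : 'I_s * 'I_n => z p.1 p.2] j i].
    by apply/forallP => j; apply/forallP => i; rewrite extendE ffunE.
  rewrite mul1r [RHS]rmorphM /= rmorph_nat mulrC; congr (_ * (_)%:C).
  (* Truncating z to n digits and padding by 0 does not change its level-n cell. *)
  congr Rintegral; apply/seteqP; split => t zt j; have [t01 tz] := zt j;
    split=> // i lt_in.
    by rewrite tz// (extendE _ j (Ordinal lt_in)) ffunE.
  by rewrite tz// (extendE _ j (Ordinal lt_in)) ffunE.
move=> a az; under eq_bigr => k _ do rewrite -mulrA [(_^*)%C * _]mulrC.
rewrite -big_distrr /= sum_walG_conj//.
case: forallP => [za|_]; last by rewrite mul0r mulr0.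
case/negP: az; apply/eqP/ffunP => -[j i]; rewrite ffunE /=.
by have /forallP/(_ i)/eqP := za j; rewrite extendE.
Qed.

(** Averages [walsh_partial_sum] over the antithetic net; by [sum_walG_net] each character averages
    to 1 or 0, which selects the indices on the left. *)
Lemma walsh_partial_sum_net m (C : 'I_s -> nat -> 'I_m -> 'Z_b) n :
  \sum_(k : {ffun 'I_s -> 'I_(b ^ n)} |
      `[< dual_net C [ffun j => (k j : nat)] /\
          digit_sums b [ffun j => (k j : nat)] = 0 >])
    walsh_coef b f [ffun j => (k j : nat)] =
  (#|{: 'Z_b * 'I_(b ^ m)}|%:R^-1 * \sum_p (b ^ (n * s))%:R *
     cell_integral f (badic_antithetic (digital_net C) p) n)%:C.
Proof.
have I0 : (#|{: 'Z_b * 'I_(b ^ m)}|%:R : R[i]) != 0.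
  by rewrite pnatr_eq0 card_prod !card_ord muln_eq0 negb_or/= -lt0n expn_gt0 ltnW.
apply: (mulfI I0); rewrite -[in RHS](rmorph_nat (real_complex R)) -rmorphM /= mulrA.
rewrite divff ?mul1r; last first.
  by rewrite -(fmorph_eq0 (real_complex R)) rmorph_nat.
rewrite rmorph_sum /=; under [RHS]eq_bigr => p _ do rewrite -walsh_partial_sum.
rewrite exchange_big /= big_mkcond big_distrr /=; apply: eq_bigr => k _.
rewrite -big_distrr /= sum_walG_net//.
by case: asboolP => _; rewrite ?mul1r ?mul0r ?mulr0// mulrC.
Qed.

Lemma walsh_coef0 : walsh_coef b f [ffun=> 0%N] = (cube_integral f)%:C.
Proof.
have wals0 x : wals b [ffun=> 0%N] x = 1 :> R[i].
  by rewrite /wals big1// => j _; rewrite ffunE /wal big_ord0 expr0.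
rewrite /walsh_coef /cube_cintegral; congr (_ +i* _).
  by congr cube_integral; apply/funext => x; rewrite wals0 /= mulr1 mul0r subr0.
rewrite (_ : (fun x => _) = cst 0); last first.
  by apply/funext => x; rewrite wals0 /= oppr0 mulr0 mul0r addr0.
by rewrite /cube_integral /Rintegral integral0.
Qed.

End walsh_series.

(** * From convergence along boxes to the unconditional error series *)

Theorem theorem1 (R : realType) (b m s : nat)
    (hb : (2 <= b)%N) (hm : (1 <= m)%N) (hs : (1 <= s)%N)
    (C : 'I_s -> nat -> 'I_m -> 'Z_b)
    (f : 'rV[R]_s -> R)
    (hf : {within @cube R s, continuous f})
    (hsum : (\esum_(k in [set: {ffun 'I_s -> nat}])
               (Normc.normc (walsh_coef b f k))%:E < +oo)%E) :
  has_sum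
    [set k | (dual_net C `\ [ffun=> 0%N]) k /\ digit_sums b k = 0]
    (walsh_coef b f)
    ((sample_mean (fun p => projs R (badic_antithetic (digital_net C) p)) f
      - cube_integral f)%:C)%C.
Proof.
pose embed n (k : {ffun 'I_s -> 'I_(b ^ n)}) : {ffun 'I_s -> nat} :=
  [ffun j => (k j : nat)].
have embed_inj n : injective (@embed n).
  move=> k l /ffunP kl; apply/ffunP => j; apply/val_inj.
  by have := kl j; rewrite !ffunE.
(* The exhausting finite sets are the boxes of all k with every k_j below b^n. *)
pose K n : {fset {ffun 'I_s -> nat}} :=
  [fset embed n k | k : {ffun 'I_s -> 'I_(b ^ n)}]%fset.
have sumK n (P : pred {ffun 'I_s -> nat}) :
    (\sum_(k <- K n | P k) walsh_coef b f k =
     \sum_(k : {ffun 'I_s -> 'I_(b ^ n)} | P (embed n k)) walsh_coef b f (embed n k)).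
  rewrite big_mkcond /= big_imfset /=; last by move=> ? ? _ _; exact: embed_inj.
  by rewrite [RHS]big_mkcond /= enumT.
apply: (has_sum_exhaustion hsum (K := K)).
  (* From n = max k_j on, k lies in the box, as k_j <= n < b^n. *)
  move=> k; exists (\max_j k j)%N => // n /= kn.
  have kb j : (k j < b ^ n)%N.
    apply: leq_ltn_trans (leq_trans _ kn) (ltn_expl n hb).
    exact: (leq_bigmax j).
  apply/imfsetP; exists [ffun j => Ordinal (kb j)] => //.
  by apply/ffunP => j; rewrite !ffunE.
(* [r n] is the box sum with the zero index included, by [walsh_partial_sum_net], and also the net
   average of cell averages, hence tends to the sample mean. *)
pose r n := #|{: 'Z_b * 'I_(b ^ m)}|%:R^-1 * \sum_p (b ^ (n * s))%:R *
     cell_integral f (badic_antithetic (digital_net C) p) n.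
have sumKD n : \sum_(k <- K n | k \in
      [set k | (dual_net C `\ [ffun=> 0%N]) k /\ digit_sums b k = 0])
    walsh_coef b f k = ((r n)%:C - (cube_integral f)%:C)%C.
  have bn0 : (0 < b ^ n)%N by rewrite expn_gt0 ltnW.
  (* The zero index satisfies both selection conditions; removing it subtracts its coefficient, the
     integral of f. *)
  pose k0 : {ffun 'I_s -> 'I_(b ^ n)} := [ffun=> Ordinal bn0].
  have k0E : embed n k0 = [ffun=> 0%N] by apply/ffunP => j; rewrite !ffunE.
  rewrite sumK -(walsh_partial_sum_net hb hf) [X in _ = X - _](bigD1 k0)/=; last first.
    rewrite -/(embed n k0) k0E; apply/asboolP; split.
      by move=> i; rewrite big1// => j _; rewrite ffunE big_ord0.
    by rewrite /digit_sums big1// => j _; rewrite ffunE /digit_sum big_ord0.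
  rewrite -/(embed n k0) k0E walsh_coef0 [RHS]addrAC subrr add0r.
  apply: eq_bigl => k; rewrite -/(embed n k); apply/idP/andP.
    rewrite inE => -[[dk k0'] sk]; split; first exact/asboolP.
    by apply: contra_notN k0' => /eqP ->; rewrite k0E.
  move=> [/asboolP[dk sk] kk0]; rewrite inE; split=> //; split=> //.
  by apply: contraNnot kk0; rewrite -k0E => /embed_inj ->.
have cvgr : r n @[n --> \oo] -->
    sample_mean (fun p => projs R (badic_antithetic (digital_net C) p)) f.
  rewrite /r /sample_mean; apply: cvgM; first exact: cvg_cst.
  apply: cvg_big => [|p _]; first exact: add_continuous.
  exact: cell_average_cvg.
move=> e e0; have [N _ NP] := (cvgrPdist_lt _ _).1 cvgr e e0.
exists N => // n /NP /= re; rewrite sumKD.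
rewrite (_ : _ - _ = (sample_mean (fun p => projs R
  (badic_antithetic (digital_net C) p)) f - r n)%:C%C); last first.
  by rewrite !rmorphB /=; ring.
by rewrite /Normc.normc /= expr0n addr0 sqrtr_sqr.
Qed.
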